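(* Let $A$ and $B$ be commutative unital C*-algebras and let $\varphi\colon A\to B$ be a unital $*$-homomorphism. If $\varphi$ is injective and $B$ has real rank zero, then the quotient group $\mathrm{K}_0(B)/\mathrm{K}_0(\varphi)(\mathrm{K}_0(A))$ is torsion free. If moreover $A$ has real rank zero, then $\mathrm{K}_0(\varphi)\colon \mathrm{K}_0(A)\to\mathrm{K}_0(B)$ is injective.
   Context: $\mathrm{K}_0(\varphi)\colon \mathrm{K}_0(A)\to \mathrm{K}_0(B)$ denotes the induced homomorphism on K-theory, determined by $\mathrm{K}_0(\varphi)([p]_0)=[\varphi(p)]_0$ for projections $p$ in matrix algebras over $A$. A unital C*-algebra has real rank zero if the invertible self-adjoint elements are dense in the self-adjoint elements. An abelian group $G$ is torsion free if $nx=0$ implies $x=0$ for all $n\in\mathbb{N}=\{1,2,\dots\}$ and $x\in G$. *)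

(* Defs.v *)
From HB Require Import structures.
From mathcomp Require Import all_boot all_order all_algebra ring_quotient.
From mathcomp Require Import all_classical all_reals all_analysis.
From mathcomp Require Import complex.

Set Implicit Arguments.
Unset Strict Implicit.
Unset Printing Implicit Defensive.

Import Order.TTheory GRing.Theory Num.Theory.
Import numFieldNormedType.Exports.

Local Open Scope classical_set_scope.
Local Open Scope ring_scope.
Local Open Scope quotient_scope.

(* The product is a field of the mixin, and the ring structure is an instance
   derived from it: the algebra structures of MathComp require 1 != 0, whereas
   the zero algebra is a unital C*-algebra. Norms of complex normed modules are
   (nonnegative real) elements of R[i]. *)
HB.mixin Record isUnitalCStar (R : realType) A
    of CompleteNormedModule R[i] A := {
  cmul : A -> A -> A;
  cone : A;
  star : A -> A;
  cmulA : associative cmul;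
  cmul1x : left_id cone cmul;
  cmulx1 : right_id cone cmul;
  cmulDl : left_distributive cmul +%R;
  cmulDr : right_distributive cmul +%R;
  cscaleAl : forall (k : R[i]) (x y : A), k *: cmul x y = cmul (k *: x) y;
  cscaleAr : forall (k : R[i]) (x y : A), k *: cmul x y = cmul x (k *: y);
  norm_cmul : forall x y : A, `|cmul x y| <= `|x| * `|y|;
  starK : involutive star;
  starD : {morph star : x y / x + y};
  starZ : forall (k : R[i]) (x : A), star (k *: x) = k^* *: star x;
  star_cmul : forall x y : A, star (cmul x y) = cmul (star y) (star x);
  cstar_identity : forall x : A, `|cmul (star x) x| = `|x| ^+ 2
}.

#[short(type="cstarType")]
HB.structure Definition UnitalCStar (R : realType) :=
  {A of isUnitalCStar R A & CompleteNormedModule R[i] A}.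

HB.instance Definition _ (R : realType) (A : cstarType R) :=
  GRing.Zmodule_isPzRing.Build (UnitalCStar.sort A)
    (@cmulA R A) (@cmul1x R A) (@cmulx1 R A) (@cmulDl R A) (@cmulDr R A).

HB.mixin Record isCommutativeCStar (R : realType) A of UnitalCStar R A := {
  cmulC : commutative (cmul : A -> A -> A)
}.

#[short(type="comCstarType")]
HB.structure Definition ComUnitalCStar (R : realType) :=
  {A of isCommutativeCStar R A & UnitalCStar R A}.

HB.instance Definition _ (R : realType) (A : comCstarType R) :=
  GRing.PzRing.copy (ComUnitalCStar.sort A) (UnitalCStar.sort A).
HB.instance Definition _ (R : realType) (A : comCstarType R) :=
  GRing.PzRing_hasCommutativeMul.Build (ComUnitalCStar.sort A) (@cmulC R A).

HB.mixin Record isStarHom (R : realType) (A B : cstarType R) (f : A -> B) := {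
  starhom1 : f 1 = 1;
  starhomM : {morph f : x y / x * y};
  starhom_star : {morph f : x / star x}
}.

HB.structure Definition StarHom (R : realType) (A B : cstarType R) :=
  {f of isStarHom R A B f & @GRing.Linear R[i] A B *:%R f}.

Notation "{ 'starhom' A -> B }" := (@StarHom.type _ A%type B%type)
  (at level 0, A at level 98, B at level 99) : type_scope.

HB.instance Definition _ (R : realType) (A B : cstarType R)
    (f : {starhom A -> B}) :=
  GRing.isMonoidMorphism.Build A B (StarHom.sort f)
    (conj (@starhom1 R A B f) (@starhomM R A B f)).

Section RealRankZero.
Variables (R : realType) (A : cstarType R).

Definition selfadjoint (a : A) : Prop := star a = a.

Definition invertible (a : A) : Prop := exists b : A, a * b = 1 /\ b * a = 1.

Definition real_rank_zero : Prop :=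
  [set a | selfadjoint a] `<=` closure [set a | selfadjoint a /\ invertible a].

End RealRankZero.

Section Grothendieck.
Variable M : nmodType.

Definition groth_rel : rel (M * M) :=
  fun x y => `[< exists c : M, x.1 + y.2 + c = y.1 + x.2 + c >].

Lemma groth_rel_equiv : equiv_class_of groth_rel.
Proof.
split=> [x|x y|y x z]; first by apply/asboolP; exists 0.
  by apply/asboolP/asboolP => -[c e]; exists c.
move=> /asboolP[c e] /asboolP[d f]; apply/asboolP.
exists (y.2 + c + (y.1 + d)).
rewrite [LHS](AC (2*(2*2)) ((1*3*4)*(5*2*6))) /= e f.
by rewrite [LHS](AC (3*3) ((4*2)*((5*3)*(1*6)))) /=.
Qed.

Canonical groth_equivRel := EquivRelPack groth_rel_equiv.

(* The class of (a, b) in the Grothendieck group is the formal difference a - b. *)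
Definition groth := {eq_quot groth_rel}.

HB.instance Definition _ := Choice.on groth.

Definition groth_pi (x : M * M) : groth := \pi_{eq_quot groth_rel} x.

Lemma groth_piP (x y : M * M) :
  groth_pi x = groth_pi y <-> exists c : M, x.1 + y.2 + c = y.1 + x.2 + c.
Proof.
split; first by move/eqP; rewrite /groth_pi piE => /asboolP.
by move=> h; apply/eqP; rewrite /groth_pi piE; apply/asboolP.
Qed.

Lemma groth_reprK (x : groth) : groth_pi (repr x) = x.
Proof. exact: reprK. Qed.

Definition groth_add (x y : groth) : groth :=
  groth_pi ((repr x).1 + (repr y).1, (repr x).2 + (repr y).2).

Definition groth_opp (x : groth) : groth := groth_pi ((repr x).2, (repr x).1).

Lemma groth_addE (a b c d : M) :
  groth_add (groth_pi (a, b)) (groth_pi (c, d)) = groth_pi (a + c, b + d).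
Proof.
have /groth_piP[/= u eu] := groth_reprK (groth_pi (a, b)).
have /groth_piP[/= v ev] := groth_reprK (groth_pi (c, d)).
apply/groth_piP => /=; exists (u + v).
move: (repr _) (repr _) eu ev => [a1 b1] [c1 d1] /= eu ev.
rewrite [LHS](AC (2*2*2) ((1*3*5)*(2*4*6))) /= eu ev.
by rewrite [LHS](AC (3*3) ((1*4)*(2*5)*(3*6))) /=.
Qed.

Lemma groth_oppE (a b : M) : groth_opp (groth_pi (a, b)) = groth_pi (b, a).
Proof.
have /groth_piP[/= u eu] := groth_reprK (groth_pi (a, b)).
apply/groth_piP => /=; exists u; move: (repr _) eu => [a1 b1] /= eu.
by rewrite (addrC b1) -eu (addrC b).
Qed.

Lemma groth_ind (P : groth -> Prop) :
  (forall a b, P (groth_pi (a, b))) -> forall x, P x.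
Proof. by move=> h x; rewrite -(groth_reprK x); case: (repr x). Qed.

Lemma groth_addA : associative groth_add.
Proof.
elim/groth_ind=> a b; elim/groth_ind=> c d; elim/groth_ind=> e f.
by rewrite !groth_addE !addrA.
Qed.

Lemma groth_addC : commutative groth_add.
Proof.
elim/groth_ind=> a b; elim/groth_ind=> c d.
by rewrite !groth_addE addrC (addrC b).
Qed.

Lemma groth_add0 : left_id (groth_pi (0, 0)) groth_add.
Proof. by elim/groth_ind=> a b; rewrite groth_addE !add0r. Qed.

Lemma groth_addN : left_inverse (groth_pi (0, 0)) groth_opp groth_add.
Proof.
elim/groth_ind=> a b; rewrite groth_oppE groth_addE.
by apply/groth_piP; exists 0; rewrite /= !addr0 add0r addrC.
Qed.

HB.instance Definition _ :=
  GRing.isZmodule.Build groth groth_addA groth_addC groth_add0 groth_addN.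

Lemma groth_piB (a b c d : M) :
  groth_pi (a, b) - groth_pi (c, d) = groth_pi (a + d, b + c).
Proof. by rewrite -groth_addE -(groth_oppE c d). Qed.

Definition to_groth (a : M) : groth := groth_pi (a, 0).

Lemma groth_piE (a b : M) : groth_pi (a, b) = to_groth a - to_groth b.
Proof. by rewrite groth_piB addr0 add0r. Qed.

End Grothendieck.

Section GrothendieckMap.
Variables (M N : nmodType) (f : {additive M -> N}).

Definition groth_map (x : groth M) : groth N :=
  groth_pi (f (repr x).1, f (repr x).2).

Lemma groth_mapE (a b : M) : groth_map (groth_pi (a, b)) = groth_pi (f a, f b).
Proof.
have /groth_piP[/= u eu] := groth_reprK (groth_pi (a, b)).
by apply/groth_piP; exists (f u); rewrite /= -!raddfD eu.
Qed.

Lemma groth_map_zmod_morphism : zmod_morphism groth_map.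
Proof.
elim/groth_ind=> a b; elim/groth_ind=> c d.
by rewrite groth_piB !groth_mapE groth_piB !raddfD.
Qed.

HB.instance Definition _ :=
  GRing.isZmodMorphism.Build (groth M) (groth N) groth_map
    groth_map_zmod_morphism.

End GrothendieckMap.

Section Projections.
Variables (R : realType) (A : cstarType R).

Definition starmx m n (M : 'M[A]_(m, n)) : 'M[A]_(n, m) := map_mx star M^T.

Definition is_projection n : pred 'M[A]_n :=
  fun p => (starmx p == p) && (p *m p == p).

(* Projections in matrix algebras of all sizes; size 0 contributes only the
   zero projection. *)
Definition projections := {n : nat & {p : 'M[A]_n | is_projection p}}.

Implicit Types p q r : projections.

Definition projdim p : nat := tag p.
Definition projmx p : 'M[A]_(projdim p) := val (tagged p).

Definition mkproj n (M : 'M[A]_n) (hM : is_projection M) : projections :=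
  Tagged (fun n => {p : 'M[A]_n | is_projection p}) (exist _ M hM).

(* Murray-von Neumann equivalence, the partial isometry being rectangular. *)
Definition mvn p q : Prop :=
  exists v : 'M[A]_(projdim q, projdim p),
    starmx v *m v = projmx p /\ v *m starmx v = projmx q.

Lemma star0 : star (0 : A) = 0.
Proof. by apply: (@addrI _ (star 0)); rewrite -starD !addr0. Qed.

Lemma starMr (x y : A) : star (x * y) = star y * star x.
Proof. exact: star_cmul. Qed.

Lemma star_sum I (s : seq I) (P : pred I) (F : I -> A) :
  star (\sum_(i <- s | P i) F i) = \sum_(i <- s | P i) star (F i).
Proof. by rewrite (big_morph _ (@starD R A) star0). Qed.

Lemma starmxK m n (M : 'M[A]_(m, n)) : starmx (starmx M) = M.
Proof. by apply/matrixP => i j; rewrite !mxE starK. Qed.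

Lemma starmxM m n k (M : 'M[A]_(m, n)) (N : 'M[A]_(n, k)) :
  starmx (M *m N) = starmx N *m starmx M.
Proof.
apply/matrixP => i j; rewrite !mxE star_sum; apply: eq_bigr => l _.
by rewrite !mxE starMr.
Qed.

Lemma starmx0 m n : starmx (0 : 'M[A]_(m, n)) = 0.
Proof. by apply/matrixP => i j; rewrite !mxE star0. Qed.

Lemma starmx_block m1 m2 n1 n2 (M1 : 'M[A]_(m1, n1)) (M2 : 'M[A]_(m1, n2))
    (M3 : 'M[A]_(m2, n1)) (M4 : 'M[A]_(m2, n2)) :
  starmx (block_mx M1 M2 M3 M4) =
    block_mx (starmx M1) (starmx M3) (starmx M2) (starmx M4).
Proof. by rewrite /starmx tr_block_mx map_block_mx. Qed.

Lemma projmx_star p : starmx (projmx p) = projmx p.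
Proof. by have /andP[/eqP] := valP (tagged p). Qed.

Lemma projmx_idem p : projmx p *m projmx p = projmx p.
Proof. by have /andP[_ /eqP] := valP (tagged p). Qed.

Lemma dsum_subproof p q :
  is_projection (block_mx (projmx p) 0 0 (projmx q)).
Proof.
apply/andP; split; apply/eqP.
  by rewrite starmx_block !starmx0 !projmx_star.
by rewrite mulmx_block !mulmx0 !mul0mx !projmx_idem !addr0 !add0r.
Qed.

Definition dsum p q : projections := mkproj (dsum_subproof p q).

Lemma proj0_subproof : is_projection (0 : 'M[A]_0).
Proof. by rewrite /is_projection starmx0 mulmx0 eqxx. Qed.

Definition proj0 : projections := mkproj proj0_subproof.

Lemma mvn_refl p : mvn p p.
Proof. by exists (projmx p); rewrite projmx_star projmx_idem. Qed.

Lemma mvn_sym p q : mvn p q -> mvn q p.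
Proof. by case=> v [vp vq]; exists (starmx v); rewrite starmxK. Qed.

Lemma mvn_trans q p r : mvn p q -> mvn q r -> mvn p r.
Proof.
case=> v [vp vq] [w [wq wr]]; exists (w *m v); rewrite starmxM; split.
  rewrite mulmxA -(mulmxA (starmx v)) wq -vq mulmxA vp -mulmxA vp.
  exact: projmx_idem.
rewrite mulmxA -(mulmxA w) vq -wq mulmxA wr -mulmxA wr.
exact: projmx_idem.
Qed.

Lemma mvn_dsum p p' q q' : mvn p p' -> mvn q q' -> mvn (dsum p q) (dsum p' q').
Proof.
case=> v [vp vp'] [w [wq wq']]; exists (block_mx v 0 0 w).
rewrite starmx_block !starmx0 !mulmx_block !mulmx0 !mul0mx !addr0 !add0r.
by rewrite vp vp' wq wq'.
Qed.

Lemma mvn_dsumC p q : mvn (dsum p q) (dsum q p).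
Proof.
exists (block_mx 0 (projmx q) (projmx p) 0).
rewrite starmx_block !starmx0 !projmx_star !mulmx_block.
by rewrite !mulmx0 !mul0mx !addr0 !add0r !projmx_idem.
Qed.

Lemma mvn_dsum0 p : mvn (dsum proj0 p) p.
Proof.
exists (row_mx 0 (projmx p)).
have -> : starmx (row_mx 0 (projmx p)) = col_mx (0 : 'M[A]_(0, projdim p)) (projmx p).
  by rewrite /starmx tr_row_mx map_col_mx -!/(starmx _) starmx0 projmx_star.
rewrite mul_row_col mul_col_row !mulmx0 !mul0mx add0r projmx_idem; split=> //.
Qed.

Lemma mvn_dsumA p q r : mvn (dsum p (dsum q r)) (dsum (dsum p q) r).
Proof.
pose P := projmx p; pose Q := projmx q; pose S := projmx r.
exists (block_mx (col_mx P 0) (block_mx 0 0 Q 0) 0 (row_mx 0 S)).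
rewrite starmx_block.
have -> : starmx (@col_mx _ _ (projdim q) _ P 0) = row_mx P 0.
  by rewrite /starmx tr_col_mx map_row_mx -!/(starmx _) starmx0 projmx_star.
have -> : starmx (@row_mx _ _ (projdim q) _ 0 S) = col_mx 0 S.
  by rewrite /starmx tr_row_mx map_col_mx -!/(starmx _) starmx0 projmx_star.
rewrite starmx_block !starmx0 projmx_star !mulmx_block.
rewrite !mulmx0 !mul0mx !addr0 !add0r.
rewrite !(mul_row_col, mul_row_block, mul_block_col, mul_col_row, mul_mx_row).
rewrite !mulmx0 !mul0mx !addr0 !add0r !row_mx0 !col_mx0.
rewrite !add_block_mx !addr0 !add0r !projmx_idem.
by split.
Qed.

Definition mvnb : rel projections := fun p q => `[< mvn p q >].

Lemma mvnb_equiv : equiv_class_of mvnb.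
Proof.
split=> [p|p q|q p r]; first by apply/asboolP; exact: mvn_refl.
  by apply/asboolP/asboolP; exact: mvn_sym.
by move=> /asboolP pq /asboolP qr; apply/asboolP; exact: mvn_trans pq qr.
Qed.

Canonical mvnb_equivRel := EquivRelPack mvnb_equiv.

Definition mvn_classes := {eq_quot mvnb}.

HB.instance Definition _ := Choice.on mvn_classes.

Definition mvn_class p : mvn_classes := \pi_{eq_quot mvnb} p.

Lemma mvn_classP p q : mvn_class p = mvn_class q <-> mvn p q.
Proof.
split; first by move/eqP; rewrite /mvn_class piE => /asboolP.
by move=> h; apply/eqP; rewrite /mvn_class piE; apply/asboolP.
Qed.

Lemma mvn_reprK (x : mvn_classes) : mvn_class (repr x) = x.
Proof. exact: reprK. Qed.

Definition mvn_add (x y : mvn_classes) : mvn_classes :=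
  mvn_class (dsum (repr x) (repr y)).

Lemma mvn_addE p q : mvn_add (mvn_class p) (mvn_class q) = mvn_class (dsum p q).
Proof. by apply/mvn_classP; apply: mvn_dsum; apply/mvn_classP/mvn_reprK. Qed.

Lemma mvn_addA : associative mvn_add.
Proof.
move=> x y z; rewrite -(mvn_reprK x) -(mvn_reprK y) -(mvn_reprK z) !mvn_addE.
exact/mvn_classP/mvn_dsumA.
Qed.

Lemma mvn_addC : commutative mvn_add.
Proof. by move=> x y; exact/mvn_classP/mvn_dsumC. Qed.

Lemma mvn_add0 : left_id (mvn_class proj0) mvn_add.
Proof.
by move=> x; rewrite -(mvn_reprK x) mvn_addE; exact/mvn_classP/mvn_dsum0.
Qed.

HB.instance Definition _ :=
  GRing.isNmodule.Build mvn_classes mvn_addA mvn_addC mvn_add0.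

Definition K0 := groth mvn_classes.

HB.instance Definition _ := GRing.Zmodule.on K0.

Definition K0_class p : K0 := to_groth (mvn_class p).

Lemma K0_standard_picture (x : K0) :
  exists p q : projections, x = K0_class p - K0_class q.
Proof.
elim/groth_ind: x => a b; exists (repr a), (repr b).
by rewrite /K0_class !mvn_reprK groth_piE.
Qed.

Lemma K0_classD p q : K0_class (dsum p q) = K0_class p + K0_class q.
Proof.
rewrite /K0_class /to_groth -mvn_addE -[RHS]/(groth_add _ _).
by rewrite groth_addE addr0.
Qed.

Lemma K0_class_eqP p q :
  K0_class p = K0_class q <-> exists r, mvn (dsum p r) (dsum q r).
Proof.
rewrite /K0_class /to_groth groth_piP /= !addr0.
split=> [[c]|[r /mvn_classP]]; last first.
  by rewrite -!mvn_addE => e; exists (mvn_class r).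
rewrite -(mvn_reprK c) => e; exists (repr c).
by apply/mvn_classP; rewrite -!mvn_addE.
Qed.

End Projections.

Section K0Map.
Variables (R : realType) (A B : cstarType R) (phi : {starhom A -> B}).

Lemma map_starmx m n (M : 'M[A]_(m, n)) :
  map_mx phi (starmx M) = starmx (map_mx phi M).
Proof. by apply/matrixP => i j; rewrite !mxE starhom_star. Qed.

Lemma projection_map_subproof (p : projections A) :
  is_projection (map_mx phi (projmx p)).
Proof.
apply/andP; split; apply/eqP; first by rewrite -map_starmx projmx_star.
by rewrite -map_mxM projmx_idem.
Qed.

Definition projection_map (p : projections A) : projections B :=
  mkproj (projection_map_subproof p).

Lemma mvn_projection_map p q :
  mvn p q -> mvn (projection_map p) (projection_map q).
Proof.
case=> v [vp vq]; exists (map_mx phi v).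
by rewrite -map_starmx -!map_mxM vp vq.
Qed.

Lemma projection_map_dsum p q :
  mvn (projection_map (dsum p q))
      (dsum (projection_map p) (projection_map q)).
Proof.
suff <- : projection_map (dsum p q) =
  dsum (projection_map p) (projection_map q) by exact: mvn_refl.
congr (Tagged _ _); apply: val_inj => /=.
by rewrite /projmx /= map_block_mx !map_mx0.
Qed.

Definition mvn_map (x : mvn_classes A) : mvn_classes B :=
  mvn_class (projection_map (repr x)).

Lemma mvn_mapE p : mvn_map (mvn_class p) = mvn_class (projection_map p).
Proof. exact/mvn_classP/mvn_projection_map/mvn_classP/mvn_reprK. Qed.

Lemma mvn_map_nmod_morphism : nmod_morphism mvn_map.
Proof.
split.
  rewrite -[LHS]/(mvn_map (mvn_class (proj0 A))) mvn_mapE; apply/mvn_classP.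
  by exists 0; split; apply/matrixP => -[].
move=> x y; rewrite -(mvn_reprK x) -(mvn_reprK y).
rewrite -[LHS]/(mvn_map (mvn_add _ _)) -[RHS]/(mvn_add _ _).
rewrite mvn_addE !mvn_mapE mvn_addE.
exact/mvn_classP/projection_map_dsum.
Qed.

HB.instance Definition _ :=
  GRing.isNmodMorphism.Build (mvn_classes A) (mvn_classes B) mvn_map
    mvn_map_nmod_morphism.

Definition K0_map : K0 A -> K0 B := groth_map mvn_map.

HB.instance Definition _ := GRing.Additive.on K0_map.

Lemma K0_map_class (p : projections A) :
  K0_map (K0_class p) = K0_class (projection_map p).
Proof. by rewrite /K0_map /K0_class /to_groth groth_mapE raddf0 /= mvn_mapE. Qed.

End K0Map.

Section AdditiveImage.
Variables (U V : zmodType) (f : {additive U -> V}).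

Definition additive_image : {pred V} := fun y => `[< exists x : U, f x = y >].

Lemma additive_image_zmod_closed : zmod_closed additive_image.
Proof.
split=> [|x y]; first by apply/asboolP; exists 0; rewrite raddf0.
move=> /asboolP[u <-] /asboolP[v <-]; apply/asboolP.
by exists (u - v); rewrite raddfB.
Qed.

HB.instance Definition _ :=
  GRing.isZmodClosed.Build V additive_image additive_image_zmod_closed.

End AdditiveImage.

Definition coker (U V : zmodType) (f : {additive U -> V}) : zmodType :=
  Quotient.quot (additive_image f).

Definition torsion_free (G : zmodType) : Prop :=
  forall (n : nat) (x : G), (0 < n)%N -> x *+ n = 0 -> x = 0.

(* Main.v *)
(* The trace K_0(B) -> B is additive, natural, and invariant under Murray-von
   Neumann equivalence because B is commutative. If B has real rank zero, K_0(B)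
   is generated by the classes of projections of B itself: cutting by a projection
   of B makes either p_00 or 1 - p_00 invertible, and a Schur complement reduces
   the size of p (or of 1 - p). Hence every x in K_0(B) is a sum of m_k [e_k]
   with e_k orthogonal projections of sum 1, and the trace of x, the sum of
   m_k e_k, vanishes only if x = 0. This gives the injectivity statement. If n x
   is the image of y, then sum m_k e_k = phi (tr y / n), so by Lagrange
   interpolation each projection sum_{m_k = c} e_k lies in the image of phi, and x
   in that of K_0(A). The functional calculus is replaced by square roots obtained
   as fixed points of y |-> (x + y^2) / 2. *)
Require Import Defs.
From mathcomp Require Import all_boot all_order all_algebra.
From mathcomp Require Import all_classical all_reals all_analysis.
From mathcomp Require Import complex.
From HB Require Import structures.
From mathcomp Require Import ring_quotient ring.

Set Implicit Arguments.
Unset Strict Implicit.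
Unset Printing Implicit Defensive.

Import Order.TTheory GRing.Theory Num.Theory.
Import numFieldNormedType.Exports.

Local Open Scope classical_set_scope.
Local Open Scope ring_scope.
Local Open Scope quotient_scope.

(** * Contractions on a closed ball of a Banach space *)

Lemma complex_expr_lt (R : realType) (c q e : R[i]) :
  0 <= c -> 0 <= q -> q < 1 -> 0 < e -> exists n : nat, c * q ^+ n < e.
Proof.
(* Nonnegative elements of [R[i]] are real, so the claim reduces to the convergence of a real
   geometric sequence. *)
have realE (z : R[i]) : 0 <= z -> exists2 a : R, z = a%:C%C & 0 <= a.
  by case: z => a b; rewrite lecE /= => /andP[/eqP -> a0]; exists a.
move=> /realE[{}c -> _] /realE[{}q -> q0] q1 e0.
have [e1 ee _] := realE e (ltW e0).
move: q1 e0; rewrite {}ee !ltcR => q1 e0.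
have [n _ /(_ n (leqnn n))] : \forall n \near \oo, `|c * q ^+ n| < e1.
  have : (fun n => c * q ^+ n) @ \oo --> (c * 0 : R).
    by apply: cvgMr; apply: cvg_expr; rewrite ger0_norm.
  by rewrite mulr0 => /cvgr0Pnorm_lt; exact.
move=> /(le_lt_trans (ler_norm _)) h; exists n.
by rewrite -rmorphXn -rmorphM ltcR.
Qed.

(** Banach's fixed point argument for the iterates of 0. It is localised to a ball because the
    quadratic map that yields square roots contracts only near 0. *)
Lemma ball_contraction_fixpoint (R : realType) (V : completeNormedModType R[i])
    (f : V -> V) (r q : R[i]) :
  0 <= r -> 0 <= q -> q < 1 ->
  (forall x, `|x| <= r -> `|f x| <= r) ->
  (forall x y, `|x| <= r -> `|y| <= r -> `|f x - f y| <= q * `|x - y|) ->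
  exists2 x, `|x| <= r & f x = x.
Proof.
move=> r0 q0 q1 fr fq.
pose y n := iter n f 0.
have yr n : `|y n| <= r by elim: n => [|n ih]; rewrite /y ?normr0 //=; exact: fr.
have q1' : 0 < 1 - q by rewrite subr_gt0.
(* With this constant the bound [C * (1 - q) * q ^+ n] on consecutive iterates equals
   [C * (q ^+ n - q ^+ n.+1)], so the bounds telescope. *)
pose C := `|f 0| / (1 - q).
have C0 : 0 <= C by rewrite mulr_ge0 ?invr_ge0 // ltW.
have y_step n : `|y n - y n.+1| <= C * (1 - q) * q ^+ n.
  rewrite divfK ?gt_eqF //; elim: n => [|n ih].
    by rewrite expr0 mulr1 /y /= sub0r normrN.
  apply: (le_trans (fq (y n) (y n.+1) (yr _) (yr _))).
  by rewrite exprS mulrCA; exact: ler_wpM2l.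
have y_dist n m : `|y n - y (n + m)%N| <= C * (q ^+ n - q ^+ (n + m)).
  elim: m => [|m ih]; first by rewrite addn0 !subrr normr0 mulr0.
  rewrite addnS (le_trans (ler_distD (y (n + m)%N) _ _)) //.
  apply: (le_trans (lerD ih (y_step _))).
  by rewrite exprS le_eqVlt; apply/orP; left; apply/eqP; ring.
have y_cauchy e : 0 < e -> exists N, forall n, (N <= n)%N -> `|y N - y n| < e.
  move=> e0; have [N hN] := complex_expr_lt C0 q0 q1 e0.
  exists N => n Nn; rewrite -(subnKC Nn); apply: le_lt_trans hN.
  apply: (le_trans (y_dist _ _)); rewrite ler_wpM2l // gerBl.
  exact: exprn_ge0.
have /cvg_ex[/= l yl] : cvg (y @ \oo).
  apply/cauchy_cvgP; apply: cauchy_exP => e e0.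
  have [N hN] := y_cauchy e e0; exists (y N), N => // n Nn.
  rewrite /= -ball_normE; exact: hN Nn.
have y_near e : 0 < e -> exists n, `|l - y n| < e /\ `|l - y n.+1| < e.
  move=> e0; have /cvgrPdist_lt/(_ _ e0)[N _ hN] := yl.
  by exists N; split; apply: hN; rewrite /= ?leqnSn.
have lr : `|l| <= r.
  have [//|rl] := real_leP (normr_real l) (ger0_real r0).
  have [n [h _]] := y_near (`|l| - r) (eq_ind_r is_true rl (subr_gt0 _ _)).
  have := le_lt_trans (lerB_dist l (y n)) h.
  by rewrite ltrD2l ltrN2 => /lt_le_trans/(_ (yr n)); rewrite ltxx.
exists l => //; apply/eqP; rewrite -subr_eq0 -normr_le0.
(* If [f l] and [l] were at positive distance, two consecutive iterates close to [l] would make that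
   distance smaller than itself. *)
have [//|h] := real_leP (normr_real (f l - l)) (real0 _).
have [n [h1 h2]] := y_near (`|f l - l| / 2) (divr_gt0 h (ltr0Sn _ 1)).
have : `|f l - l| < `|f l - l| / 2 + `|f l - l| / 2.
  apply: (le_lt_trans (ler_distD (y n.+1) _ _)).
  rewrite ler_ltD // 1?[`|y _ - _|]distrC //.
  apply: (le_trans (fq _ _ lr (yr n))).
  by rewrite (le_trans _ (ltW h1)) // ler_piMl // ltW.
by rewrite -splitr ltxx.
Qed.

(** * Consequences of the C*-identity *)

Section CStar.
Variables (R : realType) (A : cstarType R).
Implicit Types (x y : A) (k : R[i]).

Definition cscal k : A := k *: (1 : A).

Lemma scaleAl k x y : k *: (x * y) = (k *: x) * y.
Proof. exact: cscaleAl. Qed.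

Lemma scaleAr k x y : k *: (x * y) = x * (k *: y).
Proof. exact: cscaleAr. Qed.

Lemma cscalE k x : k *: x = cscal k * x.
Proof. by rewrite -scaleAl mul1r. Qed.

Lemma cscal1 : cscal 1 = 1. Proof. exact: scale1r. Qed.

Lemma cscalD k l : cscal (k + l) = cscal k + cscal l. Proof. exact: scalerDl. Qed.

Lemma cscalM k l : cscal (k * l) = cscal k * cscal l.
Proof. by rewrite -cscalE scalerA. Qed.

Lemma star1 : star (1 : A) = 1.
Proof.
by have := starK (1 : A); rewrite -[X in star X]mul1r starMr starK mul1r.
Qed.

Lemma starN x : star (- x) = - star x.
Proof. by apply/eqP; rewrite -subr_eq0 opprK -starD addNr star0. Qed.

Lemma starB x y : star (x - y) = star x - star y.
Proof. by rewrite starD starN. Qed.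

Lemma star_cscal k : star (cscal k) = cscal k^*.
Proof. by rewrite starZ star1. Qed.

Lemma star_cscal_ge0 k : 0 <= k -> star (cscal k) = cscal k.
Proof. by move=> k0; rewrite star_cscal conj_Creal // ger0_real. Qed.

Lemma norm_mul x y : `|x * y| <= `|x| * `|y|.
Proof. exact: norm_cmul. Qed.

Lemma norm_star_mul x : `|star x * x| = `|x| ^+ 2.
Proof. exact: cstar_identity. Qed.

(** Cancel [|y|] in |y|^2 = |y* y| <= |y*| |y|, then use the result for both [x] and [star x]. *)
Lemma norm_star x : `|star x| = `|x|.
Proof.
suff h y : `|y| <= `|star y| by apply/le_anti; rewrite -{2}[x]starK !h.
have [->|/eqP y0] := pselect (y = 0); first by rewrite star0.
have : `|y| * `|y| <= `|star y| * `|y| by rewrite -expr2 -norm_star_mul norm_mul.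
by rewrite ler_pM2r // normr_gt0.
Qed.

(** Only an inequality, since the zero algebra is allowed: the norm of 1 equals its own square,
    hence is 0 or 1. *)
Lemma norm1_le1 : `|1 : A| <= 1.
Proof.
have := norm_star_mul 1; rewrite star1 mul1r.
have [-> _|/eqP n0] := pselect (`|1 : A| = 0); first exact: ler01.
by rewrite expr2 -[X in X = _]mulr1 => /(mulfI n0) <-.
Qed.

Lemma norm_le1_unitary x : star x * x = 1 -> `|x| <= 1.
Proof.
move=> e; rewrite -(@ler_pXn2r _ 2) ?nnegrE // expr1n -norm_star_mul e.
exact: norm1_le1.
Qed.

End CStar.

(** * Roots, positivity and spectral cuts in a commutative algebra *)

Section Commutative.
Variables (R : realType) (B : comCstarType R).
Implicit Types (a b c s x y : B) (e k l r : R[i]).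

Local Notation "k %:B" := (cscal B k) (at level 2, format "k %:B").

Lemma starMc x y : star (x * y) = star x * star y.
Proof. by rewrite starMr mulrC. Qed.

Lemma starX x n : star (x ^+ n) = star x ^+ n.
Proof. by elim: n => [|n ih]; rewrite ?star1 // !exprS starMc ih. Qed.

(** The inverse is a fixed point of y |-> 1 + x y, which preserves the ball of radius 1 / (1 -
    |x|). *)
Lemma neumann x : `|x| < 1 -> exists y, (1 - x) * y = 1.
Proof.
move=> x1.
have x1' : 0 < 1 - `|x| by rewrite subr_gt0.
have r0 : 0 <= (1 - `|x|)^-1 by rewrite invr_ge0 ltW.
have [|y z yr zr|y _ e] := ball_contraction_fixpoint
    (f := fun y => 1 + x * y) r0 (normr_ge0 x) x1.
- move=> y yr; apply: (le_trans (ler_normD _ _)).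
  apply: (le_trans (lerD (norm1_le1 B) (norm_mul x y))).
  rewrite -(@ler_pM2l _ (1 - `|x|)) // divff ?gt_eqF //.
  apply: (@le_trans _ _ ((1 - `|x|) * (1 + `|x| * (1 - `|x|)^-1))).
    by rewrite ler_wpM2l ?(ltW x1') // lerD2l ler_wpM2l.
  by rewrite mulrDr mulr1 mulrCA divff ?gt_eqF // mulr1 subrK.
- rewrite opprD addrACA subrr add0r -mulrBr; exact: norm_mul.
- by exists y; rewrite mulrBl mul1r -{1}e addrK.
Qed.

(** The equation (1 - y)^2 = 1 - x reads y = (x + y^2) / 2. Since [f y - f z] is (y + z)(y - z) / 2,
    the map [f] has Lipschitz constant |x| on the ball of radius |x|. *)
Lemma sqrt_1B x : star x = x -> `|x| < 1 ->
  exists y, [/\ star y = y, `|y| < 1 & (1 - y) * (1 - y) = 1 - x].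
Proof.
move=> sx x1; pose f y := 2^-1%:B * (x + y * y).
have h0 : 0 <= 2^-1 :> R[i] by rewrite invr_ge0 ler0n.
have hB : 2^-1%:B + 2^-1%:B = 1 :> B.
  by rewrite -cscalD -[in RHS](cscal1 B) [in RHS](splitr 1) mul1r.
have half z : `|2^-1%:B * z| <= 2^-1 * `|z| by rewrite -cscalE normrZ ger0_norm.
have fr y : `|y| <= `|x| -> `|f y| <= `|x|.
  move=> yx; apply: (le_trans (half _)).
  rewrite -(@ler_pM2l _ 2) ?ltr0n // mulrA divff ?pnatr_eq0 // mul1r.
  apply: (le_trans (ler_normD _ _)); rewrite mulr2n mulrDl mul1r lerD2l.
  apply: (le_trans (norm_mul _ _)); rewrite -[leRHS]mulr1.
  by rewrite ler_pM // (le_trans yx (ltW x1)).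
have fq y z : `|y| <= `|x| -> `|z| <= `|x| -> `|f y - f z| <= `|x| * `|y - z|.
  move=> yx zx.
  have -> : f y - f z = 2^-1%:B * ((y + z) * (y - z)) by rewrite /f; ring.
  apply: (le_trans (half _)).
  rewrite -(@ler_pM2l _ 2) ?ltr0n // mulrA divff ?pnatr_eq0 // mul1r mulrA.
  apply: (le_trans (norm_mul _ _)); rewrite ler_wpM2r // mulr2n mulrDl mul1r.
  by apply: (le_trans (ler_normD _ _)); rewrite lerD.
have [y yx fy] := ball_contraction_fixpoint (normr_ge0 x) (normr_ge0 x) x1 fr fq.
(* As [x] is self-adjoint, [f] commutes with [star]; hence [star y] is another fixed point in the
   ball, and the contraction estimate makes the two equal. *)
have sy : star y = y.
  apply/eqP; rewrite -subr_eq0 -normr_le0.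
  have := fq (star y) y; rewrite norm_star => /(_ yx yx).
  have -> : f (star y) = star y.
    by rewrite -{2}fy /f starMc star_cscal_ge0 // starD sx starMc.
  by rewrite fy -subr_le0 -{1}[`|star y - y|]mul1r -mulrBl pmulr_rle0 ?subr_gt0.
exists y; split=> //; first exact: le_lt_trans yx x1.
have : (2^-1%:B + 2^-1%:B) * (x + y * y) = y + y by rewrite -{3 4}fy /f; ring.
rewrite hB mul1r => e; have -> : x = y + y - y * y by rewrite -e addrK.
ring.
Qed.

Definition sa_unit a := star a = a /\ exists2 b, star b = b & a * b = 1.

(** Two applications of [sqrt_1B] give the root 1 - z with |z| < 1, invertible by [neumann]. With
    fourth roots, the square root is itself the square of a self-adjoint element, so [spos_sqr]
    applies to it. *)
Lemma fourth_root_1B x : star x = x -> `|x| < 1 ->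
  exists2 a, sa_unit a & a ^+ 4 = 1 - x.
Proof.
move=> sx /(sqrt_1B sx)[y [sy /(sqrt_1B sy)[z [sz z1 ez]] ey]].
have s1z : star (1 - z) = 1 - z by rewrite starB star1 sz.
exists (1 - z); last first.
  by rewrite -ey -ez; ring.
split=> //; have [c e] := neumann z1; exists c => //.
have e' : (1 - z) * star c = 1 by rewrite -[RHS](star1 B) -[in RHS]e starMc s1z.
by rewrite -[LHS]mul1r -{1}e mulrAC e' mul1r.
Qed.

(* For a self-adjoint [a] this says that the spectrum of [a] lies in [0, 2l]. *)
Definition spos a := star a = a /\ exists2 l : R[i], 0 < l & `|l%:B - a| <= l.

Lemma sposD a b : spos a -> spos b -> spos (a + b).
Proof.
move=> [sa [k k0 ha]] [sb [l l0 hb]]; split; first by rewrite starD sa sb.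
exists (k + l); first exact: addr_gt0.
rewrite cscalD opprD addrACA; exact: le_trans (ler_normD _ _) (lerD ha hb).
Qed.

(* With [z = s / k] of norm < 1, the element [u = z + i sqrt (1 - z^2)] is unitary,
   so its imaginary part has norm at most 1. *)
Lemma spos_sqr s : star s = s -> spos (s ^+ 2).
Proof.
move=> ss; split; first by rewrite starX ss.
(* The extra 1 makes [k] positive even for [s = 0], and the norm of s / k strictly less than 1. *)
pose k := 1 + `|s|; have k0 : 0 < k by rewrite ltr_pwDl.
have k1 : k^-1 * k = 1 by rewrite mulVf // gt_eqF.
have ki : 0 <= k^-1 by rewrite invr_ge0 ltW.
exists (k ^+ 2); first exact: exprn_gt0.
have [z zE] : exists z, z = k^-1%:B * s by exists (k^-1%:B * s).
have sz : star z = z by rewrite zE starMc star_cscal_ge0 // ss.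
have z1 : `|z| < 1.
  rewrite zE -cscalE normrZ ger0_norm // -k1 ltr_pM2l ?invr_gt0 //.
  by rewrite /k ltrDr ltr01.
have [||y [sy y1 ey]] := @sqrt_1B (z ^+ 2).
- by rewrite starX sz.
- rewrite expr2; apply: (le_lt_trans (norm_mul _ _)).
  by rewrite -expr2 expr_lt1.
have ii : 'i%:B * 'i%:B = -1 :> B by rewrite -cscalM -expr2 sqrCi /cscal scaleN1r.
have si : star ('i%:B : B) = - 'i%:B by rewrite star_cscal conjCi /cscal scaleNr.
have sy1 : star (1 - y) = 1 - y by rewrite starB star1 sy.
set u := z + 'i%:B * (1 - y).
have su : star u = z - 'i%:B * (1 - y).
  by rewrite starD starMc sz sy1 si mulNr.
have u1 : `|u| <= 1.
  apply: norm_le1_unitary; rewrite su.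
  have -> : (z - 'i%:B * (1 - y)) * u =
      z ^+ 2 - 'i%:B * 'i%:B * ((1 - y) * (1 - y)) by rewrite /u; ring.
  by rewrite ii ey mulN1r opprK addrC subrK.
have y1' : `|1 - y| <= 1.
  have e : (2 * 'i) *: (1 - y) = u - star u.
    by rewrite su cscalE cscalM [2]mulr2n cscalD cscal1 /u; ring.
  have : `|u - star u| <= 2.
    by rewrite (le_trans (ler_normB _ _)) // norm_star [2]mulr2n lerD.
  by rewrite -e normrZ normrM normCi mulr1 normr_nat ger_pMr // ltr0n.
have -> : (k ^+ 2)%:B - s ^+ 2 = k ^+ 2 *: (1 - z ^+ 2).
  have kk : k%:B * k^-1%:B = 1 :> B by rewrite -cscalM mulrC k1 cscal1.
  rewrite cscalE expr2 cscalM mulrBr mulr1; congr (_ - _).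
  have -> : k%:B * k%:B * z ^+ 2 = (k%:B * k^-1%:B) ^+ 2 * s ^+ 2 by rewrite zE; ring.
  by rewrite kk expr1n mul1r.
rewrite -ey normrZ (ger0_norm (exprn_ge0 _ (ltW k0))) ler_piMr ?exprn_ge0 ?(ltW k0) //.
by rewrite (le_trans (norm_mul _ _)) // mulr_ile1.
Qed.

(** Factor a + e as (l + e)(1 - (l - a) / (l + e)): the subtracted term has norm at most l / (l + e)
    < 1, and the scalar has a positive fourth root. *)
Lemma fourth_root_spos a e : spos a -> 0 < e ->
  exists2 b, sa_unit b & b ^+ 4 = a + e%:B.
Proof.
move=> [sa [l l0 al]] e0; have le0 : 0 < l + e by rewrite addr_gt0.
have lei : (l + e)^-1 * (l + e) = 1 by rewrite mulVf // gt_eqF.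
have leB : (l + e)%:B * (l + e)^-1%:B = 1 :> B by rewrite -cscalM mulrC lei cscal1.
have [||b [sb [c sc bc]] eb] := @fourth_root_1B ((l + e)^-1%:B * (l%:B - a)).
- by rewrite starMc starB sa !star_cscal_ge0 ?(ltW l0) // invr_ge0 ltW.
- rewrite -cscalE normrZ ger0_norm ?invr_ge0 ?(ltW le0) // -lei.
  by rewrite ltr_pM2l ?invr_gt0 // (le_lt_trans al) // ltrDl.
pose k := sqrtC (sqrtC (l + e)).
have k0 : 0 < k by rewrite !sqrtC_gt0.
have k4 : k ^+ 4 = l + e by rewrite -[4%N]/(2 * 2)%N exprM !sqrtCK.
have kk : k%:B * k^-1%:B = 1 :> B by rewrite -cscalM divff ?cscal1 // gt_eqF.
exists (k%:B * b).
  split; first by rewrite starMc sb star_cscal_ge0 // ltW.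
  exists (k^-1%:B * c); first by rewrite starMc sc star_cscal_ge0 // invr_ge0 ltW.
  by rewrite mulrACA kk bc mulr1.
have kX n : (k ^+ n)%:B = k%:B ^+ n :> B.
  by elim: n => [|n ih]; rewrite ?cscal1 // !exprS cscalM ih.
by rewrite exprMn eb -kX k4 mulrBr mulr1 mulrA leB mul1r cscalD; ring.
Qed.

(* The invertibility of [b] enters through [b^2 = b^2 (1 - e b^-2) + e], where the
   first summand is a square for small [e]. *)
Lemma abs_sqrt b : sa_unit b -> exists2 u, sa_unit u & u ^+ 4 = b ^+ 2.
Proof.
move=> [sb [c sc bc]].
pose e := (1 + `|c ^+ 2|)^-1.
have d0 : 0 < 1 + `|c ^+ 2| by rewrite ltr_pwDl.
have e0 : 0 < e by rewrite invr_gt0.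
have se : star (e%:B) = e%:B :> B by rewrite star_cscal_ge0 // ltW.
have [||w [sw _ ew]] := @sqrt_1B (e%:B * c ^+ 2).
- by rewrite starMc starX sc se.
- rewrite -cscalE normrZ ger0_norm ?(ltW e0) // -(@mulVf _ (1 + `|c ^+ 2|)) ?gt_eqF //.
  by rewrite ltr_pM2l // ltrDr ltr01.
have [||u su eu] := @fourth_root_spos ((b * (1 - w)) ^+ 2) e => //.
  by apply: spos_sqr; rewrite starMc starB star1 sb sw.
exists u => //; rewrite {}eu exprMn [X in _ * X]expr2 ew.
have -> : b ^+ 2 * (1 - e%:B * c ^+ 2) = b ^+ 2 - e%:B * (b * c) ^+ 2 by ring.
by rewrite bc expr1n mulr1 subrK.
Qed.

Lemma spos_cscalD e : 0 < e -> forall a, star a = a -> `|a| <= e -> spos (e%:B + a).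
Proof.
move=> e0 a sa ae; split; first by rewrite starD sa star_cscal_ge0 // ltW.
by exists e => //; rewrite opprD addrA subrr add0r normrN.
Qed.

(* [f] is the spectral projection of [b] on the positive half-line, where [b]
   is an invertible perturbation of [a - 1/2]. *)
Lemma real_rank_zero_cut a : real_rank_zero B -> star a = a ->
  exists f u v, [/\ star f = f, f * f = f, sa_unit u, sa_unit v &
    f * a = f * u ^+ 2 /\ (1 - f) * (1 - a) = (1 - f) * v ^+ 2].
Proof.
move=> rr sa.
have q0 : 0 < 4^-1 :> R[i] by rewrite invr_gt0.
have hq : 2^-1 = 4^-1 + 4^-1 :> R[i].
  by field.
have hB : 2^-1%:B + 2^-1%:B = 1 :> B.
  by rewrite -cscalD -[in RHS](cscal1 B) [in RHS](splitr 1) mul1r.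
have sh : star 2^-1%:B = 2^-1%:B :> B by rewrite star_cscal_ge0 // invr_ge0.
have sah : selfadjoint (a - 2^-1%:B) by rewrite /selfadjoint starB sa sh.
have [b [[sb [c [bc cb]]] ab]] := rr _ sah _ (nbhsx_ballx _ _ q0).
move: ab; rewrite -ball_normE /=; set d := _ - b => /ltW d4.
have sd : star d = d by rewrite /d starB sb sah.
have [] := @abs_sqrt b.
  split=> //; exists c => //.
  have bc' : b * star c = 1 by rewrite -[RHS](star1 B) -bc starMc sb.
  by rewrite -[LHS]mul1r -cb -mulrA bc' mulr1.
move=> u [su [u' su' uu]] e4.
(* Here [u ^+ 2] is |b|, and a = 1/2 + b + d with |d| <= 1/4. Where b = |b|, a = |b| + (1/4 + d) +
   1/4; where b = -|b|, 1 - a = |b| + (1/4 - d) + 1/4. In each case the last 1/4 supplies the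
   invertibility, and the two sums are [w ^+ 4] and [v ^+ 4]. *)
have s2 : spos (u ^+ 2) by exact: spos_sqr.
have [w hw ew] := fourth_root_spos (sposD s2 (spos_cscalD q0 sd d4)) q0.
have sd' : star (- d) = - d by rewrite starN sd.
have d4' : `|- d| <= 4^-1 by rewrite normrN.
have [v hv ev] := fourth_root_spos (sposD s2 (spos_cscalD q0 sd' d4')) q0.
have sq x : sa_unit x -> sa_unit (x ^+ 2).
  move=> [sx [y sy xy]]; split; first by rewrite starX sx.
  by exists (y ^+ 2); rewrite ?starX ?sy // -exprMn xy expr1n.
have u2 : u ^+ 2 * u' ^+ 2 = 1 by rewrite -exprMn uu expr1n.
(* This element is b / |b|, the sign [g] of [b]; the spectral projection is (1 + g) / 2. *)
have g2 : (b * u' ^+ 2) ^+ 2 = 1.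
  by rewrite exprMn -e4 -!exprM -exprMn uu expr1n.
move: g2; set g := b * u' ^+ 2 => g2.
have sg : star g = g by rewrite starMc sb starX su'.
have bg : b = g * u ^+ 2 by rewrite /g -mulrA [_ * u ^+ 2]mulrC u2 mulr1.
have ad : a = 2^-1%:B + b + d by rewrite /d; ring.
have hqB : 2^-1%:B = 4^-1%:B + 4^-1%:B :> B by rewrite -cscalD -hq.
exists (2^-1%:B * (1 + g)), (w ^+ 2), (v ^+ 2); split.
- by rewrite starMc starD star1 sh sg.
- have -> : 2^-1%:B * (1 + g) * (2^-1%:B * (1 + g)) =
    2^-1%:B * 2^-1%:B * (1 + g + g + g ^+ 2) by ring.
  rewrite g2; transitivity ((2^-1%:B + 2^-1%:B) * 2^-1%:B * (1 + g)); first ring.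
  by rewrite hB mul1r.
- exact: sq.
- exact: sq.
(* In both equations the two sides differ by g^2 - 1 times [u ^+ 2] / 2, which is 0 although not by
   a ring identity. *)
have g0 x : (g ^+ 2 - 1) * x = 0 by rewrite g2 subrr mul0r.
rewrite -!exprM ew ev; split; apply/eqP; rewrite -subr_eq0; apply/eqP.
  rewrite ad bg hqB -[RHS](g0 ((4^-1%:B + 4^-1%:B) * u ^+ 2)); ring.
have -> : 1 - 2^-1%:B * (1 + g) = 2^-1%:B * (1 - g).
  by rewrite -[X in X - _]hB; ring.
have -> : 1 - a = 2^-1%:B - b - d by rewrite ad -[X in X - _]hB; ring.
rewrite bg hqB -[RHS](g0 ((4^-1%:B + 4^-1%:B) * u ^+ 2)); ring.
Qed.

End Commutative.

(** * K-theory classes of projection matrices *)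

Section MatrixProjections.
Variables (R : realType) (A : cstarType R).

Lemma is_projectionP n (M : 'M[A]_n) :
  reflect (starmx M = M /\ M *m M = M) (is_projection M).
Proof.
by apply: (iffP andP) => -[h1 h2]; split; apply/eqP.
Qed.

Lemma starmxD m n (M N : 'M[A]_(m, n)) : starmx (M + N) = starmx M + starmx N.
Proof. by apply/matrixP => i j; rewrite !mxE starD. Qed.

Lemma starmxN m n (M : 'M[A]_(m, n)) : starmx (- M) = - starmx M.
Proof. by apply/matrixP => i j; rewrite !mxE starN. Qed.

Lemma starmxB m n (M N : 'M[A]_(m, n)) : starmx (M - N) = starmx M - starmx N.
Proof. by rewrite starmxD starmxN. Qed.

Lemma starmx_scalar n (a : A) : starmx (a%:M : 'M[A]_n) = (star a)%:M.
Proof.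
apply/matrixP => i j; rewrite !mxE eq_sym.
by case: (i == j); rewrite ?mulr1n // mulr0n star0.
Qed.

Lemma is_projection0 n : is_projection (0 : 'M[A]_n).
Proof. by apply/is_projectionP; rewrite starmx0 mulmx0. Qed.

Lemma is_projectionD n (M N : 'M[A]_n) : is_projection M -> is_projection N ->
  M *m N = 0 -> is_projection (M + N).
Proof.
move=> /is_projectionP[sM MM] /is_projectionP[sN NN] MN.
have NM : N *m M = 0 by rewrite -sM -sN -starmxM MN starmx0.
apply/is_projectionP; rewrite starmxD sM sN; split=> //.
by rewrite mulmxDl !mulmxDr MM NN MN NM addr0 add0r.
Qed.

Lemma is_projectionB n (M N : 'M[A]_n) : is_projection M -> is_projection N ->
  M *m N = N -> is_projection (M - N) /\ N *m (M - N) = 0.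
Proof.
move=> /is_projectionP[sM MM] /is_projectionP[sN NN] MN.
have NM : N *m M = N by rewrite -[LHS]starmxK starmxM sM sN MN.
split; last by rewrite mulmxBr NM NN subrr.
apply/is_projectionP; rewrite starmxB sM sN; split=> //.
by rewrite mulmxBl !mulmxBr MM NN MN NM subrr subr0.
Qed.

Lemma is_projection_block m n (M : 'M[A]_m) (N : 'M[A]_n) :
  is_projection (block_mx M 0 0 N) = is_projection M && is_projection N.
Proof.
apply/is_projectionP/andP; rewrite starmx_block !starmx0 mulmx_block.
  rewrite !mulmx0 !mul0mx !addr0 !add0r.
  move=> [/eq_block_mx[sM _ _ sN] /eq_block_mx[MM _ _ NN]].
  by split; apply/is_projectionP.
move=> [/is_projectionP[sM MM] /is_projectionP[sN NN]].
by rewrite !mulmx0 !mul0mx !addr0 !add0r sM sN MM NN.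
Qed.

(* The class of a projection matrix, with junk value [0] on other matrices. *)
Definition K0mx n (M : 'M[A]_n) : K0 A :=
  if @idP (is_projection M) is ReflectT h then K0_class (mkproj h) else 0.

Lemma K0mxE n (M : 'M[A]_n) (h : is_projection M) :
  K0mx M = K0_class (mkproj h).
Proof.
rewrite /K0mx; case: {-}_ / idP => [h'|//].
by rewrite (bool_irrelevance h' h).
Qed.

Lemma K0_classE (p : projections A) : K0_class p = K0mx (projmx p).
Proof.
case: p => n [M h]; rewrite /projmx /= (K0mxE h).
by congr (K0_class (Tagged _ _)); exact: val_inj.
Qed.

Lemma K0mx_mvn m n (V : 'M[A]_(m, n)) :
  is_projection (starmx V *m V) -> is_projection (V *m starmx V) ->
  K0mx (starmx V *m V) = K0mx (V *m starmx V).
Proof.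
move=> h1 h2; rewrite (K0mxE h1) (K0mxE h2) /K0_class; congr to_groth.
by apply/mvn_classP; exists V.
Qed.

Lemma K0mx_block m n (M : 'M[A]_m) (N : 'M[A]_n) :
  is_projection M -> is_projection N ->
  K0mx (block_mx M 0 0 N) = K0mx M + K0mx N.
Proof.
move=> hM hN; rewrite (K0mxE hM) (K0mxE hN) -K0_classD.
by rewrite K0_classE.
Qed.

(** The row (M N) is a partial isometry between the block sum of [M] and [N] and the matrix [M + N],
    the off-diagonal products being 0 by orthogonality. *)
Lemma K0mxD n (M N : 'M[A]_n) : is_projection M -> is_projection N ->
  M *m N = 0 -> K0mx (M + N) = K0mx M + K0mx N.
Proof.
move=> hM hN MN; rewrite -K0mx_block //.
have hMN := is_projectionD hM hN MN.
move: (hM) (hN) => /is_projectionP[sM MM] /is_projectionP[sN NN].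
have NM : N *m M = 0 by rewrite -sM -sN -starmxM MN starmx0.
have e1 : starmx (row_mx M N) *m row_mx M N = block_mx M 0 0 N.
  rewrite {1}/starmx tr_row_mx map_col_mx -!/(starmx _) sM sN mul_col_row.
  by rewrite MM NN MN NM.
have e2 : row_mx M N *m starmx (row_mx M N) = M + N.
  rewrite {1}/starmx tr_row_mx map_col_mx -!/(starmx _) sM sN mul_row_col.
  by rewrite MM NN.
by rewrite -e1 -e2 K0mx_mvn ?e1 ?e2 // is_projection_block hM hN.
Qed.

Lemma K0mx0 n : K0mx (0 : 'M[A]_n) = 0.
Proof.
have := K0mxD (is_projection0 n) (is_projection0 n) (mulmx0 _ _).
by rewrite addr0 -[X in X = _]addr0 => /addrI <-.
Qed.

Lemma K0_picture (x : K0 A) : exists m n (M : 'M[A]_m) (N : 'M[A]_n),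
  [/\ is_projection M, is_projection N & x = K0mx M - K0mx N].
Proof.
have [p [q ->]] := K0_standard_picture x.
exists _, _, (projmx p), (projmx q).
by rewrite !K0_classE; split=> //; [exact: (valP (tagged p))|exact: (valP (tagged q))].
Qed.

End MatrixProjections.

Lemma K0_map_mx (R : realType) (A B : cstarType R) (phi : {starhom A -> B}) n
    (M : 'M[A]_n) : is_projection M ->
  K0_map phi (K0mx M) = K0mx (map_mx phi M).
Proof.
by move=> h; rewrite (K0mxE h) K0_map_class K0_classE.
Qed.

(** * The trace on K-theory *)

Section Trace.
Variables (R : realType) (A : comCstarType R).

Definition K0_trace (x : K0 A) : A :=
  \tr (projmx (repr (repr x).1)) - \tr (projmx (repr (repr x).2)).

Lemma mvn_trace (p q : projections A) : mvn p q -> \tr (projmx p) = \tr (projmx q).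
Proof. by case=> v [<- <-]; rewrite mxtrace_mulC. Qed.

(** Shows that [K0_trace] does not depend on the chosen representatives: the stabilising summand [c]
    contributes the same trace to both sides and cancels. *)
Lemma K0_traceE (p q : projections A) :
  K0_trace (K0_class p - K0_class q) = \tr (projmx p) - \tr (projmx q).
Proof.
rewrite /K0_trace -groth_piE.
have /groth_piP[c] := groth_reprK (groth_pi (mvn_class p, mvn_class q)).
move: (repr (groth_pi _)) => [a b] /=.
rewrite -{1}(mvn_reprK a) -{1}(mvn_reprK b) -(mvn_reprK c).
rewrite -![_ + _]/(mvn_add _ _) !mvn_addE => /mvn_classP/mvn_trace.
rewrite !mxtrace_block => /addIr e.
by apply/eqP; rewrite subr_eq addrAC eq_sym subr_eq e.
Qed.

Lemma K0_trace_mx n (M : 'M[A]_n) : is_projection M -> K0_trace (K0mx M) = \tr M.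
Proof.
move=> h; rewrite -[K0mx M]subr0 -(K0mx0 A 0).
rewrite (K0mxE h) (K0mxE (is_projection0 A 0)) K0_traceE.
by rewrite /projmx /= mxtrace0 subr0.
Qed.

Lemma K0_trace_zmod_morphism : zmod_morphism K0_trace.
Proof.
move=> x y.
have [p [q ->]] := K0_standard_picture x.
have [p' [q' ->]] := K0_standard_picture y.
have -> : K0_class p - K0_class q - (K0_class p' - K0_class q') =
  K0_class (dsum p q') - K0_class (dsum q p').
  by rewrite !K0_classD opprB opprD; rewrite [LHS]addrACA.
rewrite !K0_traceE !mxtrace_block opprB opprD.
by rewrite [RHS]addrACA.
Qed.

HB.instance Definition _ :=
  GRing.isZmodMorphism.Build (K0 A) A K0_trace K0_trace_zmod_morphism.

End Trace.

Lemma K0_trace_map (R : realType) (A B : comCstarType R)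
    (phi : {starhom A -> B}) (x : K0 A) :
  K0_trace (K0_map phi x) = phi (K0_trace x).
Proof.
have [p [q ->]] := K0_standard_picture x.
rewrite K0_traceE raddfB /= !K0_map_class K0_traceE raddfB.
by rewrite /projmx /= !trace_map_mx.
Qed.

(** * Reduction to projections of the algebra itself *)

Section ScalarProjections.
Variables (R : realType) (B : comCstarType R).
Implicit Types (e f : B).

Definition eproj e := star e = e /\ e * e = e.

Lemma eproj0 : eproj 0. Proof. by split; rewrite ?star0 ?mulr0. Qed.

Lemma eproj1 : eproj 1. Proof. by split; rewrite ?star1 ?mulr1. Qed.

Lemma eprojC e : eproj e -> eproj (1 - e).
Proof.
move=> [se ee]; split; first by rewrite starB star1 se.
by rewrite mulrBl mul1r mulrBr mulr1 ee subrr subr0.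
Qed.

Lemma eprojM e f : eproj e -> eproj f -> eproj (e * f).
Proof.
by move=> [se ee] [sf ff]; split; rewrite ?starMc ?se ?sf // mulrACA ee ff.
Qed.

Lemma eprojD e f : eproj e -> eproj f -> e * f = 0 -> eproj (e + f).
Proof.
move=> [se ee] [sf ff] ef; split; first by rewrite starD se sf.
by rewrite mulrDl !mulrDr ee ff ef mulrC ef addr0 add0r.
Qed.

Lemma is_projection_scalar n e : eproj e -> is_projection (e%:M : 'M[B]_n).
Proof.
by move=> [se ee]; apply/is_projectionP; rewrite starmx_scalar se -scalar_mxM ee.
Qed.

Definition K0e e : K0 B := K0mx (e%:M : 'M[B]_1).

Lemma K0e0 : K0e 0 = 0.
Proof. by rewrite /K0e raddf0 K0mx0. Qed.

Lemma K0eD e f : eproj e -> eproj f -> e * f = 0 ->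
  K0e (e + f) = K0e e + K0e f.
Proof.
move=> he hf ef; rewrite /K0e raddfD /= K0mxD //; try exact: is_projection_scalar.
by rewrite -scalar_mxM ef raddf0.
Qed.

Lemma K0e_sum (I : finType) (P : pred I) (e : I -> B) :
  (forall i, eproj (e i)) -> (forall i j, i != j -> e i * e j = 0) ->
  eproj (\sum_(i | P i) e i) /\
  K0e (\sum_(i | P i) e i) = \sum_(i | P i) K0e (e i).
Proof.
move=> pe oe; elim: (index_enum I) (index_enum_uniq I) => [_|i r ih].
  by rewrite !big_nil K0e0; split=> //; exact: eproj0.
move=> /= /andP[ir /ih[p k]].
rewrite !big_cons; case: ifP => // Pi.
have o : e i * (\sum_(j <- r | P j) e j) = 0.
  rewrite mulr_sumr big1_seq // => j /andP[_ jr]; apply: oe.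
  by apply: contraNneq ir => ->.
by split; [exact: eprojD | rewrite K0eD // k].
Qed.

Lemma K0_trace_e e : eproj e -> K0_trace (K0e e) = e.
Proof.
by move=> he; rewrite K0_trace_mx ?mxtrace_scalar //; exact: is_projection_scalar.
Qed.

Lemma starmxZ m n (f : B) (M : 'M[B]_(m, n)) : starmx (f *: M) = star f *: starmx M.
Proof. by apply/matrixP => i j; rewrite !mxE starMc. Qed.

Lemma is_projectionZ n e (p : 'M[B]_n) : eproj e -> is_projection p ->
  is_projection (e *: p).
Proof.
move=> [se ee] /is_projectionP[sp pp]; apply/is_projectionP.
by rewrite starmxZ se sp -scalemxAl -scalemxAr pp scalerA ee.
Qed.

(** Scalars from [B] commute with matrices, so [e] and [1 - e] cut [p] into two orthogonal
    projections. *)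
Lemma K0mx_cut n e (p : 'M[B]_n) : eproj e -> is_projection p ->
  K0mx p = K0mx (e *: p) + K0mx ((1 - e) *: p).
Proof.
move=> he hp; have hc := eprojC he.
have /is_projectionP[_ pp] := hp.
rewrite -K0mxD; first by rewrite -scalerDl addrC subrK scale1r.
- exact: is_projectionZ.
- exact: is_projectionZ.
rewrite -scalemxAl -scalemxAr pp scalerA mulrBr mulr1.
by case: he => _ ->; rewrite subrr scale0r.
Qed.

(* The corner is split off by the partial isometry [p e_0 u^-1], and the Schur
   complement of the corner in [p] has zero first row and column. *)
Lemma K0mx_schur n f u (p : 'M[B]_(1 + n)) :
  eproj f -> sa_unit u -> is_projection p -> f *: p = p ->
  f * p 0 0 = f * u ^+ 2 ->
  exists2 q : 'M[B]_n, is_projection q & K0mx p = K0e f + K0mx q.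
Proof.
move=> pf [su [c sc uc]] hp fp fu.
have /is_projectionP[sp pp] := hp.
have fpE i j : f * p i j = p i j by rewrite -[in RHS]fp mxE.
have cp : c * c * p 0 0 = f.
  rewrite -fpE fu; transitivity (f * (u * c) ^+ 2); first ring.
  by rewrite uc expr1n mulr1.
pose v := c *: (p *m delta_mx 0 (0 : 'I_1)).
have sv : starmx v = c *: (delta_mx 0 0 *m p).
  rewrite /v starmxZ sc starmxM sp; congr (_ *: (_ *m _)).
  apply/matrixP => i j; rewrite !mxE andbC.
  by case: (_ && _); rewrite ?star1 ?star0.
have vv : starmx v *m v = f%:M.
  rewrite sv /v -scalemxAl -scalemxAr scalerA mulmxA -[delta_mx _ _ *m p *m p]mulmxA pp.
  rewrite -rowE -colE; apply/matrixP => i j.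
  by rewrite !ord1 !mxE cp mulr1n.
have fv : v *m f%:M = v.
  by rewrite mul_mx_scalar /v scalerA mulrC -scalerA scalemxAl fp.
have pv : p *m v = v by rewrite /v -scalemxAr mulmxA pp.
pose r := v *m starmx v.
have hr : is_projection r.
  apply/is_projectionP; rewrite /r starmxM starmxK; split=> //.
  by rewrite mulmxA -(mulmxA v) vv fv.
have pr : p *m r = r by rewrite /r mulmxA pv.
have [hpr rpr] := is_projectionB hp hr pr.
(* The first row of [r] is [c * c * p 0 0], that is [f], times the first row of [p], and [f] fixes
   [p]. The first column follows by self-adjointness. *)
have prE j : (p - r) 0 j = 0.
  rewrite /r sv /v -scalemxAl -scalemxAr scalerA mulmxA -colE -mulmxA -rowE.
  rewrite !mxE big_ord1 !mxE -[in X in X - _]fpE -cp; ring.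
have prE' i : (p - r) i 0 = 0.
  case/is_projectionP: hpr => s _; rewrite -s mxE mxE prE; exact: star0.
have e : p - r = block_mx (0 : 'M[B]_1) 0 0 (drsubmx (p - r)).
  rewrite -[LHS](@submxK _ 1 n 1 n); congr block_mx; apply/matrixP => i j.
  - rewrite !ord1 [ulsubmx _ _ _]mxE [usubmx _ _ _]mxE.
    by rewrite lshift0 prE mxE.
  - rewrite !ord1 [ursubmx _ _ _]mxE [usubmx _ _ _]mxE.
    by rewrite lshift0 prE mxE.
  - rewrite !ord1 [dlsubmx _ _ _]mxE [dsubmx _ _ _]mxE.
    by rewrite lshift0 prE' mxE.
have hq : is_projection (drsubmx (p - r)).
  by move: hpr; rewrite {1}e is_projection_block => /andP[].
exists (drsubmx (p - r)) => //.
have -> : K0mx p = K0mx r + K0mx (p - r).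
  by rewrite -K0mxD // addrC subrK.
rewrite [in K0mx (p - r)]e K0mx_block ?is_projection0 // K0mx0 add0r.
have hv : is_projection (starmx v *m v) by rewrite vv; exact: is_projection_scalar.
by rewrite -(K0mx_mvn hv hr) vv.
Qed.

(* The elements of [K0 B] that correspond to locally constant integer-valued
   functions on the spectrum of [B]. *)
Definition step (x : K0 B) := exists (I : finType) (e : I -> B) (m : I -> int),
  [/\ forall i, eproj (e i), forall i j, i != j -> e i * e j = 0,
      \sum_i e i = 1 & x = \sum_i K0e (e i) *~ m i].

Lemma step_e e : eproj e -> step (K0e e).
Proof.
move=> he; have [_ ee] := he.
exists bool, (fun b => if b then e else 1 - e).
exists (fun b : bool => (nat_of_bool b)%:Z); split.
- by case=> //; exact: eprojC.
- by case=> -[] // _; rewrite (mulrBr, mulrBl) ?mulr1 ?mul1r ee subrr.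
- by rewrite big_bool /= addrC subrK.
- by rewrite big_bool /= mulr1z mulr0z addr0.
Qed.

(** The products [e i * f j] form a common refinement of the two partitions of 1. *)
Lemma stepB x y : step x -> step y -> step (x - y).
Proof.
move=> [I [e [m [pe ore se ->]]]] [J [f [k [pf orf sf ->]]]].
exists (I * J)%type, (fun ij => e ij.1 * f ij.2), (fun ij => m ij.1 - k ij.2).
have oef (i i' : I) (j j' : J) : (i, j) != (i', j') -> e i * f j * (e i' * f j') = 0.
  rewrite xpair_eqE negb_and mulrACA => /orP[/ore ->|/orf ->]; first by rewrite mul0r.
  by rewrite mulr0.
have K0el i : K0e (e i) = \sum_j K0e (e i * f j).
  rewrite -[in LHS](mulr1 (e i)) -sf mulr_sumr.
  have [j|j j' jj|_ -> //] := @K0e_sum J xpredT (fun j => e i * f j).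
    exact: eprojM.
  by rewrite oef // xpair_eqE negb_and jj orbT.
have K0er j : K0e (f j) = \sum_i K0e (e i * f j).
  rewrite -[in LHS](mul1r (f j)) -se mulr_suml.
  have [i|i i' ii|_ -> //] := @K0e_sum I xpredT (fun i => e i * f j).
    exact: eprojM.
  by rewrite oef // xpair_eqE negb_and ii.
split.
- by move=> [i j]; exact: eprojM.
- by move=> [i j] [i' j'] /=; exact: oef.
- rewrite -(pair_bigA _ (fun i j => e i * f j)) /= -se; apply: eq_bigr => i _.
  by rewrite -mulr_sumr sf mulr1.
rewrite -(pair_bigA _ (fun i j => K0e (e i * f j) *~ (m i - k j))) /=.
transitivity (\sum_i \sum_j K0e (e i * f j) *~ m i
    - \sum_i \sum_j K0e (e i * f j) *~ k j).
  congr (_ - _); first by apply: eq_bigr => i _; rewrite K0el mulrz_suml.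
  by rewrite exchange_big; apply: eq_bigr => j _; rewrite K0er mulrz_suml.
rewrite -sumrB; apply: eq_bigr => i _; rewrite -sumrB; apply: eq_bigr => j _.
by rewrite mulrzBr.
Qed.

Lemma stepD x y : step x -> step y -> step (x + y).
Proof.
move=> hx hy; rewrite -[y]opprK; apply: stepB => //; rewrite -sub0r -K0e0.
by apply: stepB => //; apply: step_e; exact: eproj0.
Qed.

Lemma step_scalar n e : eproj e -> step (K0mx (e%:M : 'M[B]_n)).
Proof.
move=> he; elim: n => [|n ih].
  by rewrite flatmx0 K0mx0 -K0e0; apply: step_e; exact: eproj0.
rewrite -[n.+1]/(1 + n)%N scalar_mx_block K0mx_block; try exact: is_projection_scalar.
by apply: stepD => //; exact: step_e.
Qed.

Lemma step_mx n (p : 'M[B]_n) : real_rank_zero B -> is_projection p -> step (K0mx p).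
Proof.
move=> rr; elim: n p => [|n ih] p hp.
  by rewrite flatmx0 K0mx0 -K0e0; apply: step_e; exact: eproj0.
have /is_projectionP[sp pp] := hp.
have sp0 : star (p 0 0) = p 0 0 by rewrite -[in RHS]sp !mxE.
have [f [u [v [sf ff hu hv [fu fv]]]]] := real_rank_zero_cut rr sp0.
have pf : eproj f by [].
have pg := eprojC pf; have [_ gg] := pg.
rewrite (K0mx_cut pf hp); apply: stepD.
  have [||q hq ->] := @K0mx_schur n f u (f *: p) pf hu (is_projectionZ pf hp).
  - by rewrite scalerA ff.
  - by rewrite mxE mulrA ff.
  - by apply: stepD; [exact: step_e | exact: ih].
have hp' : is_projection (1%:M - p).
  apply: (is_projectionB (is_projection_scalar _ eproj1) hp _).1.
  by rewrite mul1mx.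
(* Under [1 - f] it is the corner of the complement of [p] that is invertible, so [p] is traded for
   its complement at the cost of a sign and the class of a scalar matrix. *)
have -> : K0mx ((1 - f) *: p) =
    K0mx ((1 - f)%:M : 'M[B]_n.+1) - K0mx ((1 - f) *: (1%:M - p)).
  apply/eqP; rewrite eq_sym subr_eq -K0mxD; try exact: is_projectionZ.
    by rewrite -scalerDr [p + _]addrC subrK scalemx1.
  by rewrite -scalemxAl -scalemxAr mulmxBr mulmx1 pp subrr !scaler0.
apply: stepB; first exact: step_scalar.
have [||q hq ->] :=
    @K0mx_schur n (1 - f) v ((1 - f) *: (1%:M - p)) pg hv (is_projectionZ pg hp').
- by rewrite scalerA gg.
- by rewrite !mxE eqxx mulr1n mulrA gg.
- by apply: stepD; [exact: step_e | exact: ih].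
Qed.

Lemma real_rank_zero_step x : real_rank_zero B -> step x.
Proof.
move=> rr; have [m [n [p [q [hp hq ->]]]]] := K0_picture x.
by apply: stepB; exact: step_mx.
Qed.

End ScalarProjections.

(** * Torsion in cokernels, and step elements of trace zero *)

Lemma coker_torsion_free (U V : zmodType) (f : {additive U -> V}) :
  (forall n y, (0 < n)%N -> y *+ n \in additive_image f -> y \in additive_image f) ->
  torsion_free (coker f).
Proof.
move=> h n u n0.
pose pr (y : V) : coker f := \pi_(Quotient.quot (additive_image f)) y.
have prD y z : pr (y + z) = pr y + pr z by exact: Quotient.pi_add.
have pr0 : pr 0 = 0 by apply: (addrI (pr 0)); rewrite -prD !addr0.
have prMn y : pr (y *+ n) = pr y *+ n.
  by elim: (n) => [|k ih]; rewrite ?mulr0n // !mulrS -ih prD.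
have in0 y : (y \in additive_image f) = (pr y == 0).
  by rewrite -[y in LHS]subr0 Quotient.idealrBE -pr0.
have [x <-] : exists x, pr x = u.
  by exists (repr (u : Quotient.quot (additive_image f))); exact: reprK.
by rewrite -prMn => /eqP; rewrite -in0 => /(h _ _ n0); rewrite in0 => /eqP.
Qed.

Section StepElements.
Variables (R : realType) (B : comCstarType R).

Lemma scale_intB (m : int) (b : B) : m%:~R *: b = b *~ m :> B.
Proof. exact: scaler_int. Qed.

Lemma trace_step (I : finType) (e : I -> B) (m : I -> int) :
  (forall i, eproj (e i)) ->
  K0_trace (\sum_i K0e (e i) *~ m i) = \sum_i e i *~ m i.
Proof.
move=> pe; rewrite raddf_sum; apply: eq_bigr => i _.
by rewrite raddfMz /= K0_trace_e.
Qed.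

Lemma trace_step_mul (I : finType) (e : I -> B) (m : I -> int) j :
  (forall i, eproj (e i)) -> (forall i j, i != j -> e i * e j = 0) ->
  (\sum_i e i *~ m i) * e j = e j *~ m j.
Proof.
move=> pe oe; rewrite mulr_suml (bigD1 j) //= mulrzAl (pe j).2 big1 ?addr0 //.
by move=> i ij; rewrite mulrzAl oe // mul0rz.
Qed.

(** Multiplying the trace by [e j] isolates m_j e_j = 0; in a complex vector space this forces m_j =
    0 or e_j = 0, and each term of [x] vanishes. *)
Lemma step_trace_eq0 (x : K0 B) : step x -> K0_trace x = 0 -> x = 0.
Proof.
move=> [I [e [m [pe oe _ ->]]]]; rewrite trace_step // => h.
apply: big1 => j _; have := trace_step_mul m j pe oe.
rewrite h mul0r => /esym/eqP; rewrite -scale_intB scaler_eq0 intr_eq0.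
by move=> /orP[/eqP ->|/eqP ->]; rewrite ?mulr0z // K0e0 mul0rz.
Qed.

End StepElements.

(** * Step elements in the image of K-theory *)

Section Image.
Variables (R : realType) (A B : comCstarType R) (phi : {starhom A -> B}).

Lemma K0_map_e (w : A) : eproj w -> K0_map phi (K0e w) = K0e (phi w).
Proof.
move=> hw; rewrite (K0_map_mx phi (is_projection_scalar 1 hw)).
by rewrite map_scalar_mx.
Qed.

Lemma eproj_preim (w : A) : injective phi -> eproj (phi w) -> eproj w.
Proof.
move=> phi_inj [sw ww]; split; apply: phi_inj; first by rewrite starhom_star.
by rewrite starhomM.
Qed.

(** On each [e k], [phi z] acts as the integer [m k], so a polynomial in [z] acts as its value
    there. The one used is the Lagrange polynomial vanishing on [s] and normalised at [c]. *)
Lemma lagrange_preim (I : finType) (e : I -> B) (m : I -> int) (z : A) (c : int) s :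
  (forall k, phi z * e k = e k *~ m k) ->
  exists w : A, forall k,
    phi w * e k = (\prod_(d <- s) ((m k - d)%:~R / (c - d)%:~R)) *: e k.
Proof.
move=> hz; elim: s => [|d s [w hw]].
  by exists 1 => k; rewrite big_nil scale1r starhom1 mul1r.
exists ((c - d)%:~R^-1 *: ((z - d%:~R *: (1 : A)) * w)) => k.
rewrite linearZ /= starhomM linearB linearZ /= starhom1 big_cons.
rewrite -scaleAl -mulrA hw -scaleAr mulrBl hz -scaleAl mul1r -scale_intB -scalerBl.
by rewrite !scalerA -intrB; congr (_ *: _); ring.
Qed.

Lemma step_in_image (x : K0 B) (z : A) :
  injective phi -> step x -> K0_trace x = phi z ->
  x \in additive_image (K0_map phi).
Proof.
move=> phi_inj [I [e [m [pe oe se ->]]]]; rewrite trace_step // => tz.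
have hz k : phi z * e k = e k *~ m k by rewrite -tz trace_step_mul.
pose s := undup [seq m k | k <- enum I].
have ms k : m k \in s by rewrite mem_undup map_f // mem_enum.
(* Terms with equal coefficient are grouped, because polynomials in [phi z] separate only the level
   sets of [m], not the individual [e k]. *)
have -> : \sum_k K0e (e k) *~ m k =
    \sum_(c <- s) K0e (\sum_(k | m k == c) e k) *~ c.
  transitivity (\sum_k \sum_(c <- s | m k == c) K0e (e k) *~ c).
    apply: eq_bigr => k _; rewrite big_mkcond (bigD1_seq (m k)) ?undup_uniq //=.
    by rewrite eqxx big1 ?addr0 // => c; rewrite eq_sym => /negPf ->.
  rewrite (exchange_big_dep xpredT) //=; apply: eq_bigr => c _.
  by rewrite (K0e_sum _ pe oe).2 mulrz_suml.
rewrite big_seq; apply: rpred_sum => c cs; apply: rpredMz.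
(* Removing [c] from the nodes keeps the denominators nonzero, so that [phi w] acts on [e k] as 1 if
   [m k = c] and as 0 otherwise. *)
have [w hw] := lagrange_preim c [seq d <- s | d != c] hz.
have ew : phi w = \sum_(k | m k == c) e k.
  rewrite -[phi w]mulr1 -se mulr_sumr [RHS]big_mkcond /=; apply: eq_bigr => k _.
  rewrite hw big_filter; case: eqVneq => [->|mc].
    rewrite big1 ?scale1r // => d dc; rewrite divff // intr_eq0 subr_eq0 eq_sym.
    exact: dc.
  by rewrite (big_rem (m k)) //= mc subrr mul0r mul0r scale0r.
have hew := (K0e_sum (fun k => m k == c) pe oe).1.
have pw : eproj w by apply: (eproj_preim phi_inj); rewrite ew.
by apply/asboolP; exists (K0e w); rewrite -ew; exact: K0_map_e.
Qed.

End Image.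

Theorem theorem1p1 (R : realType) (A B : comCstarType R)
    (phi : {starhom A -> B}) :
  injective phi -> real_rank_zero B ->
  torsion_free (coker (K0_map phi)) /\
  (real_rank_zero A -> injective (K0_map phi)).
Proof.
move=> phi_inj rrB; split.
  apply: coker_torsion_free => n x n0 /asboolP[y yx].
  (* Since n x is the image of [y], naturality gives n tr(x) = phi(tr(y)), and the division by n can
     be made in [A]. *)
  apply: (step_in_image (z := n%:R^-1 *: K0_trace y) phi_inj).
    exact: real_rank_zero_step.
  rewrite linearZ /= -K0_trace_map yx raddfMn /= -[K0_trace x *+ n]scaler_nat.
  by rewrite scalerA mulVf ?scale1r // pnatr_eq0 -lt0n.
move=> rrA; apply: raddf_inj => x hx.
apply: step_trace_eq0; first exact: real_rank_zero_step.
by apply: phi_inj; rewrite -K0_trace_map hx !raddf0.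
Qed.
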